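(* Let $m,n\ge 1$. If there exists a binary $(mn,R)$-covering sequence of length $k$ where $n$ divides $k$, then there exists an $(m\times n,R)$-covering 2D-sequence of size $M\times N$ with $M=k/n$ and $N=2n-1$. If there exists a binary $(mn,R)$-covering sequence of length $k$ where $n$ does not divide $k$, then there exists an $(m\times n,R)$-covering 2D-sequence of size $M\times N$ with $N=2n-1$ and $\frac{k}{n}\le M\le\left\lceil\frac{k}{n}\right\rceil+m$.
   Context: A cyclic binary sequence of length $k$ has as its windows of length $L$ the words $(s_i,\ldots,s_{i+L-1})$, $0\le i\le k-1$, indices modulo $k$; it is an $(L,R)$-covering sequence if every $x\in\{0,1\}^L$ is within Hamming distance $R$ of some window. An $M\times N$ binary array $A=(A_{r,c})$ is regarded as doubly periodic (a torus); its $m\times n$ windows are the arrays $(A_{(r+a)\bmod M,\,(c+b)\bmod N})_{0\le a<m,\,0\le b<n}$ for $0\le r<M$, $0\le c<N$. It is an $(m\times n,R)$-covering 2D-sequence if for every binary $m\times n$ matrix $B$ there is a window $X$ with $d(B,X)\le R$, where $d$ counts differing entries. *)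

(* Defs.v *)
From mathcomp Require Import all_boot all_order all_algebra.

Set Implicit Arguments.
Unset Strict Implicit.
Unset Printing Implicit Defensive.

Local Open Scope ring_scope.

(* (i + a) mod k; having i : 'I_k forces k > 0. *)
Definition cyc_shift (k : nat) (i : 'I_k) (a : nat) : 'I_k :=
  Ordinal (ltn_pmod (i + a) (leq_ltn_trans (leq0n i) (ltn_ord i))).

Definition hamming (m n : nat) (X Y : 'M[bool]_(m, n)) : nat :=
  #|[set p : 'I_m * 'I_n | X p.1 p.2 != Y p.1 p.2]|.

Definition seq_window (k L : nat) (s : 'rV[bool]_k) (i : 'I_k) : 'rV[bool]_L :=
  \row_(j < L) s ord0 (cyc_shift i j).

(* No relation between k and L is imposed: a window may wrap around
   several times. The empty sequence (k = 0) has no window, hence is never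
   covering. *)
Definition covering_seq (L R k : nat) (s : 'rV[bool]_k) : Prop :=
  forall x : 'rV[bool]_L, exists i : 'I_k, (hamming x (seq_window L s i) <= R)%N.

Definition torus_window (M N m n : nat) (A : 'M[bool]_(M, N))
    (r : 'I_M) (c : 'I_N) : 'M[bool]_(m, n) :=
  \matrix_(a < m, b < n) A (cyc_shift r a) (cyc_shift c b).

Definition covering_2Dseq (m n R M N : nat) (A : 'M[bool]_(M, N)) : Prop :=
  forall B : 'M[bool]_(m, n), exists (r : 'I_M) (c : 'I_N),
    (hamming B (torus_window m n A r c) <= R)%N.

(* Main.v *)
Require Import Defs.
From mathcomp Require Import all_boot all_order all_algebra.
From mathcomp Require Import zify.

(** Write the sequence in the array by [A r c = s (r * n + c)]: consecutive rows
    start [n] letters apart and overlap in [n - 1] letters, so the [m * n]-window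
    of [s] at [i], cut into [m] rows of length [n], is the array window at
    [(i %/ n, i %% n)], without wrapping around in the columns. Wrapping around in
    the rows is harmless when [n] divides [k]; otherwise [m - 1] more rows than
    [ceil (k / n)] make it unnecessary. *)

Import Order.TTheory GRing.Theory Num.Theory.

Local Open Scope ring_scope.

(** Row-major reading. Searching for the pair avoids bound proofs for [j %/ n] and [j %% n]; the
    default [false] is never reached. *)
Definition flatten_mx (m n : nat) (B : 'M[bool]_(m, n)) : 'rV[bool]_(m * n) :=
  \row_j oapp (fun p : 'I_m * 'I_n => B p.1 p.2) false
           [pick p : 'I_m * 'I_n | (p.1 * n + p.2 == j)%N].

Lemma flatten_index_lt (m n : nat) (p : 'I_m * 'I_n) :
  (p.1 * n + p.2 < m * n)%N.
Proof. by case: p => [[a ha] [b hb]] /=; nia. Qed.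

Definition flatten_ord (m n : nat) (p : 'I_m * 'I_n) : 'I_(m * n) :=
  Ordinal (flatten_index_lt m n p).

Lemma flatten_ord_inj (m n : nat) : injective (flatten_ord m n).
Proof.
move=> [[a ha] [b hb]] [[a' ha'] [b' hb']] /(congr1 val) /= e.
have ea : a = a' by nia.
have eb : b = b' by nia.
by congr pair; apply: val_inj.
Qed.

Lemma flatten_mxE (m n : nat) (B : 'M[bool]_(m, n)) (p : 'I_m * 'I_n) :
  flatten_mx m n B ord0 (flatten_ord m n p) = B p.1 p.2.
Proof.
rewrite mxE; case: pickP => [q /eqP e | /(_ p)]; last by rewrite eqxx.
by have -> : q = p by apply: flatten_ord_inj; apply: val_inj.
Qed.

(** [flatten_ord] injects the disagreements of the matrices into those of the words. *)
Lemma hamming_flatten (m n : nat) (B X : 'M[bool]_(m, n))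
    (y : 'rV[bool]_(m * n)) :
  (forall p, y ord0 (flatten_ord m n p) = X p.1 p.2) ->
  (hamming B X <= hamming (flatten_mx m n B) y)%N.
Proof.
move=> yE.
have inj : injective (fun p => (ord0 : 'I_1, flatten_ord m n p)).
  by move=> p q /(congr1 snd) /flatten_ord_inj.
rewrite /hamming -(card_imset _ inj); apply/subset_leq_card/subsetP => q.
by case/imsetP=> p; rewrite !inE => hp -> /=; rewrite flatten_mxE yE.
Qed.

(** Common core of both cases. The last hypothesis ensures that reducing a row index modulo [M]
    leads to the same letters of [s]. *)
Lemma covering_2Dseq_of_seq (m n R k M : nat) (s : 'rV[bool]_k) :
  (0 < n)%N -> covering_seq (m * n) R s ->
  (forall i, (i < k)%N -> (i %/ n < M)%N) ->
  (forall i a, (i < k)%N -> (a < m)%N ->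
     ((i %/ n + a) %% M * n = (i %/ n + a) * n %[mod k])%N) ->
  exists A : 'M[bool]_(M, 2 * n - 1), covering_2Dseq m n R A.
Proof.
move=> n0 cov rowM rowk.
have k0 : (0 < k)%N.
  by case: (cov 0) => i _; apply: leq_ltn_trans (ltn_ord i).
exists (\matrix_(r, c) s ord0 (cyc_shift (Ordinal k0) (r * n + c))) => B.
case: (cov (flatten_mx m n B)) => i hi.
have cN : (i %% n < 2 * n - 1)%N by have := ltn_pmod i n0; lia.
exists (Ordinal (rowM i (ltn_ord i))), (Ordinal cN).
apply: leq_trans (hamming_flatten _ _ _ _ _ _) hi => -[a b] /=.
rewrite !mxE; congr (s _ _); apply: val_inj => /=.
have hb := ltn_ord b; have hc := ltn_pmod i n0.
(* Both summands are at most [n - 1], hence the width [2 * n - 1]. *)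
rewrite add0n (@modn_small (i %% n + b)); last by lia.
rewrite -[RHS]modnDml rowk // modnDml.
congr (_ %% _)%N; rewrite {1}(divn_eq i n); lia.
Qed.

Theorem theorem7 (m n R k : nat) (hm : (1 <= m)%N) (hn : (1 <= n)%N) :
  ((n %| k)%N ->
   (exists s : 'rV[bool]_k, covering_seq (m * n) R s) ->
   exists A : 'M[bool]_(k %/ n, 2 * n - 1), covering_2Dseq m n R A)
  /\
  (~~ (n %| k)%N ->
   (exists s : 'rV[bool]_k, covering_seq (m * n) R s) ->
   exists (M : nat) (A : 'M[bool]_(M, 2 * n - 1)),
     [/\ (k%:R / n%:R : rat) <= M%:R,
         M%:Z <= Num.ceil (k%:R / n%:R : rat) + m%:Z
       & covering_2Dseq m n R A]).
Proof.
split=> [dvd_nk [s cov] | _ [s cov]].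
- apply: (covering_2Dseq_of_seq _ _ _ _ _ _ hn cov) => [i hi | i a _ _].
    by rewrite ltn_divLR // divnK.
  (* Multiplication by [n] turns reduction modulo [k %/ n] into reduction modulo [k]. *)
  by rewrite muln_modl divnK // modn_mod.
- have [i hi | i a hi ha | A covA] :=
    covering_2Dseq_of_seq m n R k (k %/ n + m) s hn cov.
  + by have := leq_div2r n (ltnW hi); lia.
  (* No wrapping: the row is at most [k %/ n + (m - 1)]. *)
  + by rewrite (@modn_small (i %/ n + a)) //; have := leq_div2r n (ltnW hi); lia.
  have n0 : (0 : rat) < n%:R by rewrite ltr0n.
  (* For [n] not dividing [k], this is the ceiling of [k / n] plus [m - 1]. *)
  exists (k %/ n + m)%N, A; split=> //.
    rewrite ler_pdivrMr // -natrM ler_nat.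
    by have := ltn_ceil k hn; nia.
  rewrite PoszD lerD2r -(ler_int rat); apply: le_trans (ceil_ge _).
  by rewrite ler_pdivlMr // -natrM ler_nat leq_divM.
Qed.
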